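(* Let $p\in[1,\infty]$ and let $E$ be a Banach lattice which is $p$-convex with constant $1$ and whose order is induced by a $1$-unconditional basis. Then $\mathrm{FBL}^{(p)}[E]$ contains a lattice isometric copy of $E$ as a sublattice. Moreover, there exists a contractive lattice homomorphic projection from $\mathrm{FBL}^{(p)}[E]$ onto this sublattice.
   Context: Banach spaces and lattices are real. A Banach lattice $X$ is $p$-convex with constant $M$ if $\|(\sum_{k=1}^n|x_k|^p)^{1/p}\|\le M(\sum_{k=1}^n\|x_k\|^p)^{1/p}$ for all $x_1,\dots,x_n\in X$ (for $p=\infty$: $\|\bigvee_k|x_k|\|\le M\max_k\|x_k\|$). The order induced by a ($1$-unconditional, finite or infinite) basis $(e_i)$ is the coordinatewise one: $\sum a_ie_i\ge 0$ iff $a_i\ge0$ for all $i$. $H[E]$ is the vector lattice (pointwise operations) of positively homogeneous functions $f:E^*\to\mathbb R$. For $1\le p<\infty$ put $\|f\|_{\mathrm{FBL}^{(p)}[E]}=\sup\{(\sum_{k=1}^n|f(x_k^* )|^p)^{1/p}: n\in\mathbb N,\ x_1^*,\dots,x_n^*\in E^*,\ \sup_{x\in B_E}\sum_{k=1}^n|x_k^*(x)|^p\le 1\}$, and for $p=\infty$ put $\|f\|_{\mathrm{FBL}^{(\infty)}[E]}=\sup_{x^*\in B_{E^*}}|f(x^* )|$. For $x\in E$ let $\delta_x(x^* )=x^*(x)$. $\mathrm{FBL}^{(p)}[E]$ is the closure, in the space of $f\in H[E]$ with finite norm, of the sublattice generated by $\{\delta_x:x\in E\}$. A lattice homomorphic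 projection is an idempotent lattice homomorphism. *)

(* Defs.v *)
From HB Require Import structures.
From mathcomp Require Import all_boot all_order all_algebra.
From mathcomp Require Import all_classical all_reals all_analysis.

Set Implicit Arguments.
Unset Strict Implicit.
Unset Printing Implicit Defensive.

Import Order.TTheory GRing.Theory Num.Theory.
Import numFieldNormedType.Exports.

Local Open Scope classical_set_scope.
Local Open Scope ring_scope.

(* The order is part of the mixin rather than inherited from [Order.Lattice]:
   Hierarchy-Builder admits no join of [Order.Lattice] and [CompleteNormedModule]
   below the existing number structures.  The last axiom is
   |x| <= |y| -> ||x|| <= ||y||, with the modulus |x| = x \/ (- x) spelled out,
   since [`|x|] denotes the norm. *)
HB.mixin Record CompleteNormedModule_isBanachLattice (R : realType) E
    & CompleteNormedModule R E := {
  lle : E -> E -> Prop ;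
  ljoin : E -> E -> E ;
  lmeet : E -> E -> E ;
  lle_refl : forall x, lle x x ;
  lle_anti : forall x y, lle x y -> lle y x -> x = y ;
  lle_trans : forall y x z, lle x y -> lle y z -> lle x z ;
  ljoinP : forall x y z, lle (ljoin x y) z <-> lle x z /\ lle y z ;
  lmeetP : forall x y z, lle z (lmeet x y) <-> lle z x /\ lle z y ;
  lle_add2l : forall z x y, lle x y -> lle (z + x) (z + y) ;
  lle_scale : forall (a : R) x y, 0 <= a -> lle x y -> lle (a *: x) (a *: y) ;
  lle_norm : forall x y, lle (ljoin x (- x)) (ljoin y (- y)) -> `|x| <= `|y|
}.

#[short(type="banachLatticeType")]
HB.structure Definition BanachLattice (R : realType) :=
  { E of CompleteNormedModule R E & CompleteNormedModule_isBanachLattice R E }.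

Definition modulus (R : realType) (E : banachLatticeType R) (x : E) : E :=
  ljoin x (- x).

(* An operator T : U -> V between vector lattices, considered on a linear
   sublattice D of U.  The lattice operations are arguments so that the notion
   applies both to Banach lattices and to spaces of functions. *)
Definition lattice_hom_on (R : realType) (U V : lmodType R) (D : set U)
    (joinU meetU : U -> U -> U) (joinV meetV : V -> V -> V) (T : U -> V) :=
  [/\ forall (a : R) (f g : U), D f -> D g -> T (a *: f + g) = a *: T f + T g,
      forall f g : U, D f -> D g -> T (joinU f g) = joinV (T f) (T g)
    & forall f g : U, D f -> D g -> T (meetU f g) = meetV (T f) (T g)].

Definition fjoin (R : realType) (T : Type) (f g : T -> R) : T -> R := f \max g.
Definition fmeet (R : realType) (T : Type) (f g : T -> R) : T -> R := f \min g.

Section PConvex.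
Context (R : realType) (E : banachLatticeType R).

Definition lp_norm (r : R) n (t : 'I_n -> R) : R :=
  (\sum_(k < n) `|t k| `^ r) `^ r^-1.

Definition linfty_norm n (t : 'I_n -> R) : R := \big[Num.max/0]_(k < n) `|t k|.

(* Continuous positively homogeneous functions on R^n. *)
Definition cont_homogeneous n : set ('rV[R]_n.+1 -> R) :=
  [set h | continuous h /\
           forall (c : R) (t : 'rV[R]_n.+1), 0 <= c -> h (c *: t) = c * h t].

(* [Phi h] is h(x_0, ..., x_n) in the sense of Krivine's functional calculus:
   the (unique) lattice homomorphism sending the k-th coordinate to x_k. *)
Definition krivine_calculus n (x : 'I_n.+1 -> E)
    (Phi : ('rV[R]_n.+1 -> R) -> E) : Prop :=
  lattice_hom_on (@cont_homogeneous n) (@fjoin R _) (@fmeet R _)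
    ljoin lmeet Phi
  /\ forall k, Phi (fun t => t ord0 k) = x k.

(* For infinite p the join of the nonempty family |x_k| is taken with |x_0| as
   starting value, as E has no bottom element. *)
Definition p_convex (p : \bar R) (M : R) : Prop :=
  if p is r%:E then
    forall n (x : 'I_n.+1 -> E) Phi, krivine_calculus x Phi ->
      `|Phi (fun t => lp_norm r (t ord0))| <= M * lp_norm r (fun k => `|x k|)
  else
    forall n (x : 'I_n.+1 -> E),
      `|\big[ljoin/modulus (x ord0)]_(k < n.+1) modulus (x k)|
        <= M * linfty_norm (fun k => `|x k|).

End PConvex.

Section Basis.
Context (R : realType) (E : banachLatticeType R).

(* A basis is a family e_i (i < m) if N = Some m, and (e_i)_(i : nat) if
   N = None; the values of e outside of the index set are ignored. *)
Definition basis_index (N : option nat) : pred nat :=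
  fun i => if N is Some m then (i < m)%N else true.

Definition supported_on (N : option nat) (a : nat -> R) :=
  forall i, ~~ basis_index N i -> a i = 0.

Definition expansion N (e : nat -> E) (a : nat -> R) (x : E) : Prop :=
  supported_on N a /\ series (fun i => a i *: e i) @ \oo --> x.

Definition schauder_basis N (e : nat -> E) : Prop :=
  forall x : E, exists! a : nat -> R, expansion N e a x.

Definition one_unconditional N (e : nat -> E) : Prop :=
  forall n (a : nat -> R) (s : nat -> bool), supported_on N a ->
    `|\sum_(i < n) ((-1) ^+ s i * a i) *: e i| <= `|\sum_(i < n) a i *: e i|.

Definition order_induced_by N (e : nat -> E) : Prop :=
  forall a (x : E), expansion N e a x -> (lle 0 x <-> forall i, 0 <= a i).

End Basis.

Section Dual.
Context (R : realType) (E : normedModType R).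

Definition dual_pred : {pred E -> R} :=
  [pred f : E -> R | `[< linear f /\ continuous f >]].

Lemma dual_pred_submod_closed : submod_closed dual_pred.
Proof.
split.
  apply/asboolP; split=> [a x y|]; last by move=> x; exact: cvg_cst.
  by rewrite /= scaler0 addr0.
move=> a f g; move=> /asboolP[lf cf] /asboolP[lg cg].
apply/asboolP; split=> [b x y|x].
  rewrite [LHS](_ : _ = a * f (b *: x + y) + g (b *: x + y)) // lf lg.
  rewrite [RHS](_ : _ = b * (a * f x + g x) + (a * f y + g y)) //.
  by rewrite mulrDr addrACA mulrDr mulrCA.
by apply: cvgD; [apply: cvgM; [exact: cvg_cst | exact: cf] | exact: cg].
Qed.

HB.instance Definition _ :=
  GRing.isSubmodClosed.Build R (E -> R) dual_pred dual_pred_submod_closed.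

Record dual := Dual { dual_fun :> E -> R ; dual_funP : dual_fun \in dual_pred }.

HB.instance Definition _ := [isSub for dual_fun].
HB.instance Definition _ := [Choice of dual by <:].

HB.instance Definition _ := [SubChoice_isSubLmodule of dual by <:].

Definition dual_ball : set dual :=
  [set xs | forall x : E, `|x| <= 1 -> `|xs x| <= 1].

End Dual.

Section FBL.
Context (R : realType) (E : normedModType R).

Definition positively_homogeneous : set (dual E -> R) :=
  [set f | forall (c : R) (xs : dual E), 0 <= c -> f (c *: xs) = c * f xs].

Definition weak_lp_ball (r : R) n : set ('I_n -> dual E) :=
  [set xs | forall x : E, `|x| <= 1 -> \sum_(k < n) `|xs k x| `^ r <= 1].

Definition fbl_norm (p : \bar R) (f : dual E -> R) : \bar R :=
  if p is r%:E then
    ereal_sup [set z | exists n (xs : 'I_n -> dual E),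
      weak_lp_ball r xs /\ z = (lp_norm r (fun k => f (xs k)))%:E]
  else ereal_sup [set `|f xs|%:E | xs in @dual_ball R E].

Definition delta (x : E) : dual E -> R := fun xs => xs x.

Definition linear_sublattice : set (set (dual E -> R)) :=
  [set A | [/\ A (fun=> 0),
    forall (a : R) (f g : dual E -> R), A f -> A g -> A (a *: f + g),
    forall f g : dual E -> R, A f -> A g -> A (fjoin f g)
    & forall f g : dual E -> R, A f -> A g -> A (fmeet f g)]].

Definition free_vector_lattice : set (dual E -> R) :=
  smallest linear_sublattice (range delta).

Definition FBL (p : \bar R) : set (dual E -> R) :=
  [set f | [/\ positively_homogeneous f, (fbl_norm p f < +oo)%E
    & forall eps : R, 0 < eps ->
        exists2 g, free_vector_lattice g & (fbl_norm p (f - g : dual E -> R)%R < eps%:E)%E]].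

End FBL.

Arguments FBL {R} E p _.

(* Main.v *)
(** In a lattice with coordinate functionals e_i^*, let S = sum_i w_i |delta_{e_i}|
with summable weights w_i > 0 and u_n = (2 delta_{e_n} - S / w_n)^+.  The u_n are
positive, pairwise disjoint, at most |delta_{e_n}|, and satisfy u_n(e_i^* ) = 1 if
i = n and 0 otherwise.  So T x = sum_n x_n u_n and P f = sum_n f(e_n^* ) u_n define
lattice homomorphisms with P T = T.

Upper bound ||T x|| <= ||x||: each x_k^* meets at most one u_n, so only a "diagonal"
of the matrix (x_n x_k^*(e_n)) matters, and averaging over changes of signs of the
coordinates bounds it by the weak p-summability of (x_k^* ).

Lower bound ||sum_i f(e_i^* ) e_i|| <= ||f||: p-convexity makes
t |-> ||sum_i |t_i|^(1/p) e_i||^p a norm, and Hahn-Banach gives b_i >= 0 with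
sum_i b_i |x_i|^p <= ||x||^p and equality at x_i = f(e_i^* ); the functionals
b_i^(1/p) e_i^* then witness the bound.  Together with the density of the free vector
lattice this also makes sum_i f(e_i^* ) e_i converge for f in FBL, so that P f is in
the range of T. *)
From HB Require Import structures.
Require Import Defs.
From mathcomp Require Import all_boot all_order all_algebra.
From mathcomp Require Import all_classical all_reals all_analysis.
From mathcomp Require Import ring lra.

Set Implicit Arguments.
Unset Strict Implicit.
Unset Printing Implicit Defensive.

Import Order.TTheory GRing.Theory Num.Theory.
Import numFieldNormedType.Exports.

Local Open Scope classical_set_scope.
Local Open Scope ring_scope.

(** * Convexity of the power function and finite [r]-norms *)

Section PowerMeans.
Context (R : realType) (r : R).
Hypothesis r1 : 1 <= r.

Let r0 : 0 < r. Proof. exact: lt_le_trans r1. Qed.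
Let rn0 : r != 0. Proof. by rewrite gt_eqF. Qed.

Lemma powR_le (x y : R) : 0 <= x -> x <= y -> x `^ r <= y `^ r.
Proof.
move=> x0 xy; apply: (ge0_ler_powR (ltW r0)) => //; rewrite nnegrE //.
exact: le_trans xy.
Qed.

Lemma powRK (x : R) : 0 <= x -> (x `^ r) `^ r^-1 = x.
Proof. by move=> x0; rewrite -powRrM mulfV // powRr1. Qed.

Lemma powRVK (x : R) : 0 <= x -> (x `^ r^-1) `^ r = x.
Proof. by move=> x0; rewrite -powRrM mulVf // powRr1. Qed.

Lemma powR_conv (t x y : R) : 0 <= t -> t <= 1 -> 0 <= x -> 0 <= y ->
  (t * x + (1 - t) * y) `^ r <= t * x `^ r + (1 - t) * y `^ r.
Proof.
move=> t0 t1 x0 y0.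
have := @convex_powR R r r1 (Itv01 t0 t1) x y.
rewrite !inE /= !in_itv /= !andbT => /(_ x0 y0).
by [].
Qed.

(** [a] is the midpoint of [a + b] and [a - b], so this is convexity with parameter [2^-1]. *)
Lemma powR_midpoint (a b : R) :
  2 * `|a| `^ r <= `|a + b| `^ r + `|a - b| `^ r.
Proof.
have h0 : 0 <= 2^-1 :> R by rewrite invr_ge0.
have h1 : 2^-1 <= 1 :> R by rewrite invf_le1 // ler1n.
have := powR_conv h0 h1 (normr_ge0 (a + b)) (normr_ge0 (a - b)).
have le_a : `|a| `^ r <= (2^-1 * `|a + b| + (1 - 2^-1) * `|a - b|) `^ r.
  apply: powR_le => //.
  have := ler_normD (a + b) (a - b).
  have -> : a + b + (a - b) = 2 * a by lra.
  by rewrite normrM ger0_norm //; lra.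
move: le_a; set P := (_ + _) `^ r; set X := _ `^ r; set Y := _ `^ r.
by set Z := _ `^ r; lra.
Qed.

Lemma lp_norm_ge0 n (t : 'I_n -> R) : 0 <= lp_norm r t.
Proof. exact: powR_ge0. Qed.

Lemma lp_norm_powR n (t : 'I_n -> R) :
  lp_norm r t `^ r = \sum_(k < n) `|t k| `^ r.
Proof. by rewrite powRVK //; apply: sumr_ge0 => k _; exact: powR_ge0. Qed.

Lemma lp_norm_leP n (t : 'I_n -> R) (C : R) : 0 <= C ->
  lp_norm r t <= C <-> \sum_(k < n) `|t k| `^ r <= C `^ r.
Proof.
move=> C0; split=> h.
  by rewrite -lp_norm_powR; apply: powR_le => //; exact: lp_norm_ge0.
rewrite -[leRHS]powRK //; apply: ge0_ler_powR => //.
- by rewrite invr_ge0 ltW.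
- by rewrite nnegrE; apply: sumr_ge0 => k _; exact: powR_ge0.
- by rewrite nnegrE powR_ge0.
Qed.

Lemma lp_norm_mono n (s t : 'I_n -> R) : (forall k, `|s k| <= `|t k|) ->
  lp_norm r s <= lp_norm r t.
Proof.
move=> st; apply/lp_norm_leP; first exact: lp_norm_ge0.
by rewrite lp_norm_powR; apply: ler_sum => k _; exact: powR_le.
Qed.

Lemma lp_norm_cst n (d : R) : lp_norm r (fun _ : 'I_n => d) = n%:R `^ r^-1 * `|d|.
Proof.
rewrite /lp_norm sumr_const card_ord -[_ *+ n]mulr_natl powRM ?powR_ge0 //.
by move=> *; rewrite powRK.
Qed.

(* Minkowski: (a + b) / (A + B) is a convex combination of a / A and b / B. *)
Lemma lp_normD n (a b : 'I_n -> R) (A B : R) : 0 < A -> 0 < B ->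
  lp_norm r a <= A -> lp_norm r b <= B ->
  lp_norm r (fun k => a k + b k) <= A + B.
Proof.
move=> A0 B0 aA bB; have AB0 : 0 < A + B by exact: addr_gt0.
move/lp_norm_leP : aA => /(_ (ltW A0)) aA.
move/lp_norm_leP : bB => /(_ (ltW B0)) bB.
apply/lp_norm_leP; first exact: ltW.
pose t := A / (A + B).
have t0 : 0 <= t by rewrite divr_ge0 // ltW.
have t1 : t <= 1 by rewrite ler_pdivrMr // mul1r lerDl ltW.
have tB : 1 - t = B / (A + B).
  by rewrite /t; apply: (mulIf (lt0r_neq0 AB0)); rewrite mulrBl !divfK ?lt0r_neq0 //; lra.
have key k : `|a k + b k| `^ r <=
    (A + B) `^ r * (t * (`|a k| `^ r / A `^ r) + (1 - t) * (`|b k| `^ r / B `^ r)).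
  have e (x C : R) : 0 < C -> `|x| `^ r / C `^ r = (`|x| / C) `^ r.
    move=> C0; rewrite powRM ?invr_ge0 // ?(ltW C0) //; congr (_ * _).
    by rewrite -[(C `^ r)^-1]powR_inv1 ?powR_ge0 // powRAC powR_inv1 // ltW.
  rewrite !e //.
  apply: le_trans (ler_wpM2l (powR_ge0 _ _)
    (powR_conv t0 t1 (_ : 0 <= `|a k| / A) (_ : 0 <= `|b k| / B))).
  - rewrite -powRM; [|exact: ltW|].
    + apply: powR_le => //; rewrite tB /t mulrDr !mulrA.
      have -> : (A + B) * A / (A + B) * `|a k| / A = `|a k|.
        by field; rewrite !lt0r_neq0.
      have -> : (A + B) * B / (A + B) * `|b k| / B = `|b k|.
        by field; rewrite !lt0r_neq0.
      exact: ler_normD.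
    + by rewrite addr_ge0 // mulr_ge0 ?divr_ge0 ?subr_ge0 // ltW.
  - by rewrite divr_ge0 // ltW.
  - by rewrite divr_ge0 // ltW.
apply: le_trans (ler_sum _ (fun k _ => key k)) _.
rewrite -mulr_sumr -[leRHS]mulr1; apply: ler_wpM2l; first exact: powR_ge0.
rewrite big_split /= -!mulr_sumr -!mulr_suml.
have ha : (\sum_(i < n) `|a i| `^ r) / A `^ r <= 1.
  by rewrite ler_pdivrMr ?mul1r // powR_gt0.
have hb : (\sum_(i < n) `|b i| `^ r) / B `^ r <= 1.
  by rewrite ler_pdivrMr ?mul1r // powR_gt0.
have t1' : 0 <= 1 - t by rewrite subr_ge0.
have := ler_wpM2l t0 ha; have := ler_wpM2l t1' hb; lra.
Qed.

(* Averaging over the sign of the last column, convexity bounds the p-th power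
   of either summand. *)
Lemma diagonal_le n (K : pred 'I_n) (J : nat) (c : 'I_n -> nat -> R)
    (col : 'I_n -> nat) (B : R) :
  (forall k, K k -> (col k < J)%N) ->
  (forall s : nat -> bool,
     \sum_(k < n | K k) `|\sum_(j < J) (-1) ^+ s j * c k j| `^ r <= B) ->
  \sum_(k < n | K k) `|c k (col k)| `^ r <= B.
Proof.
elim: J K B => [|J IH] K B colJ hB.
  rewrite big_pred0; last by move=> k; apply/negP => /colJ.
  apply: le_trans (hB (fun=> false)); apply: sumr_ge0 => k _; exact: powR_ge0.
pose L k := K k && (col k == J).
have -> : \sum_(k < n | K k) `|c k (col k)| `^ r =
    \sum_(k < n | L k) `|c k J| `^ r +
    \sum_(k < n | K k && (col k != J)) `|c k (col k)| `^ r.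
  rewrite (bigID (fun k => col k == J)) /=; congr (_ + _).
  by apply: eq_bigr => k /andP[_ /eqP ->].
(* The induction hypothesis is applied to the rows whose selected column is not [J], with the bound
   lowered by what the rows in [L] contribute. *)
rewrite -lerBrDl; apply: IH => [k /andP[/colJ]|s].
  by rewrite ltnS leq_eqVlt => /orP[/eqP ->|//]; rewrite eqxx.
rewrite lerBrDl.
pose x k := \sum_(j < J) (-1) ^+ s j * c k j.
(* Both ways of extending the signs [s] to column [J] obey the bound; adding the two and pairing
   them row by row leads to [powR_midpoint]. *)
have flip (b : bool) :
    \sum_(k < n | K k) `|x k + (-1) ^+ b * c k J| `^ r <= B.
  pose s' j := if (j < J)%N then s j else b.
  apply: le_trans (hB s'); apply: ler_sum => k _.
  rewrite big_ord_recr /= /s' ltnn (eq_bigr (fun j : 'I_J => (-1) ^+ s j * c k j)) //.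
  by move=> j _; rewrite ltn_ord.
have := lerD (flip false) (flip true); rewrite -big_split /=.
rewrite (bigID (fun k => col k == J)) /=.
(* In the rows of [L] the midpoint keeps the entry [c k J] and cancels [x k]; in the other rows
   ([h2]) the roles are exchanged. *)
have h1 : 2 * (\sum_(k < n | L k) `|c k J| `^ r) <=
    \sum_(k < n | K k && (col k == J))
      (`|x k + 1 * c k J| `^ r + `|x k + -1 * c k J| `^ r).
  rewrite mulr_sumr; apply: ler_sum => k _.
  have := powR_midpoint (c k J) (x k).
  by rewrite -[X in _ + X `^ _]normrN opprB mul1r mulN1r [c k J + _]addrC.
have h2 : 2 * (\sum_(k < n | K k && (col k != J)) `|x k| `^ r) <=
    \sum_(k < n | K k && (col k != J))
      (`|x k + 1 * c k J| `^ r + `|x k + -1 * c k J| `^ r).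
  rewrite mulr_sumr; apply: ler_sum => k _.
  by have := powR_midpoint (x k) (c k J); rewrite mul1r mulN1r.
by rewrite /= expr0 expr1 => h3; rewrite /x in h1 h2 h3 *; lra.
Qed.

End PowerMeans.

(** * Hahn-Banach in finite dimension, by lowering a sublinear function *)

Section HahnBanach.
Context (R : realType) (V : lmodType R).
Implicit Types q : V -> R.

Definition sublinear q := (forall x y, q (x + y) <= q x + q y) /\
  (forall (a : R) x, 0 <= a -> q (a *: x) = a * q x).

Lemma sublinear0 q : sublinear q -> q 0 = 0.
Proof. by case=> _ h; rewrite -(scale0r 0) h // mul0r. Qed.

Lemma sublinear_ge q : sublinear q -> forall v, 0 <= q v + q (- v).
Proof. by move=> sq v; rewrite -(sublinear0 sq) -(subrr v); exact: sq.1. Qed.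

(** The minorant is the infimum of [q (x + t *: v) - t * q v] over [t >= 0]. It is bounded below by
    [- q (- x)], and [t = 1] at [x = - v] yields the value [- q v]. *)
Lemma sublinear_step q v : sublinear q ->
  exists q', [/\ sublinear q', forall x, q' x <= q x & q' (- v) = - q v].
Proof.
move=> sq; have [sqD sqZ] := sq.
pose A x := [set q (x + t *: v) - t * q v | t in [set t : R | 0 <= t]].
have lbA x t : 0 <= t -> - q (- x) <= q (x + t *: v) - t * q v.
  move=> t0; rewrite -sqZ //.
  have : q (t *: v) <= q (x + t *: v) + q (- x).
    by apply: le_trans (sqD _ _); rewrite addrAC subrr add0r.
  lra.
have hlb x : has_lbound (A x) by exists (- q (- x)) => _ [t t0 <-]; exact: lbA.
have A0 x : A x !=set0 by exists (q (x + 0 *: v) - 0 * q v); exists 0 => //=.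
have infA x t : 0 <= t -> inf (A x) <= q (x + t *: v) - t * q v.
  by move=> t0; apply: ge_inf => //; exists t.
have homle (a : R) x : 0 < a -> inf (A (a *: x)) <= a * inf (A x).
  move=> a0; rewrite -ler_pdivrMl //; apply: lb_le_inf => // _ [t t0 <-].
  rewrite ler_pdivrMl //; apply: le_trans (infA _ _ (mulr_ge0 (ltW a0) t0)) _.
  by rewrite -scalerA -scalerDr sqZ ?(ltW a0) // mulrBr mulrA.
exists (fun x => inf (A x)); split; first split.
- move=> x y; rewrite -lerBlDr; apply: lb_le_inf => // _ [t t0 <-].
  rewrite lerBlDr -lerBlDl; apply: lb_le_inf => // _ [u u0 <-].
  have := @infA (x + y) (t + u) (addr_ge0 t0 u0).
  rewrite scalerDl addrACA mulrDl.
  by have := sqD (x + t *: v) (y + u *: v); lra.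
- move=> a x; rewrite le_eqVlt => /predU1P[<-|a0].
    rewrite scale0r mul0r; apply/eqP; rewrite eq_le; apply/andP; split.
      by have := @infA 0 0 (lexx _); rewrite scale0r addr0 mul0r subr0 sublinear0.
    apply: lb_le_inf => // _ [t t0 <-].
    by rewrite add0r sqZ // subrr.
  apply/eqP; rewrite eq_le homle //= -ler_pdivlMl //.
  rewrite -{1}[x](scalerK (lt0r_neq0 a0)) homle // invr_gt0 //.
- by move=> x; have := @infA x 0 (lexx _); rewrite scale0r addr0 mul0r subr0.
- apply/eqP; rewrite eq_le; apply/andP; split.
    have := @infA (- v) 1 ler01.
    by rewrite scale1r addNr sublinear0 // mul1r add0r.
  apply: lb_le_inf => // _ [t t0 <-].
  by have := @lbA (- v) t t0; rewrite opprK.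
Qed.

(** Oddness at [v] freezes the value there: [q' v] and [q' (- v)] can only drop, yet their sum stays
    nonnegative. Hence repeated lowering preserves what was achieved before. *)
Lemma odd_minorant q q' v : sublinear q' -> (forall x, q' x <= q x) ->
  q (- v) = - q v -> q' v = q v /\ q' (- v) = - q' v.
Proof.
move=> sq' le_q' qv; have := sublinear_ge sq' v.
have := le_q' v; have := le_q' (- v); rewrite qv => h1 h2 h3.
have e : q' v = q v by apply/eqP; rewrite eq_le h2 /=; lra.
by split=> //; apply/eqP; rewrite eq_le; apply/andP; split; lra.
Qed.

Lemma sublinear_odd_on q (vs : seq V) : sublinear q ->
  exists q', [/\ sublinear q', forall x, q' x <= q x &
    forall v, v \in vs -> q' (- v) = - q' v].
Proof.
move=> sq; elim: vs => [|v vs [q1 [sq1 le1 odd1]]].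
  by exists q; split.
have [q2 [sq2 le2 odd2]] := sublinear_step v sq1.
exists q2; split=> // [x|w]; first exact: le_trans (le1 _).
have := sublinear_ge sq2 v; have h2 := le2 v; rewrite odd2 => h3.
rewrite inE => /predU1P[->|/odd1 /(odd_minorant sq2 le2)[] //].
by rewrite odd2; apply/eqP; rewrite eq_le; apply/andP; split; lra.
Qed.

End HahnBanach.

(** Lowering [q] first at [a] fixes the value at [a]; lowering it next at the unit vectors makes the
    result linear. *)
Lemma hahn_banach_rV (R : realType) m (q : 'rV[R]_m -> R) (a : 'rV[R]_m) :
  sublinear q ->
  exists b : 'I_m -> R, (forall t : 'rV[R]_m, \sum_(i < m) b i * t ord0 i <= q t) /\
    \sum_(i < m) b i * a ord0 i = q a.
Proof.
move=> sq.
have [q0 [sq0 le0 q0a]] := sublinear_step a sq.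
have {}q0a : q0 a = q a /\ q0 (- a) = - q0 a.
  have := sublinear_ge sq0 a; have := le0 a; rewrite q0a => h1 h2.
  have e : q0 a = q a by apply/eqP; rewrite eq_le h1 /=; lra.
  by rewrite e.
have [q1 [sq1 le1 odd1]] :=
  sublinear_odd_on [seq delta_mx ord0 i | i <- enum 'I_m] sq0.
have [q1a _] := odd_minorant sq1 le1 q0a.2.
have q1d (i : 'I_m) (x : R) :
    q1 (x *: delta_mx ord0 i) = x * q1 (delta_mx ord0 i).
  have [x0|x0] := leP 0 x; first by rewrite sq1.2.
  rewrite -[x]opprK scaleNr -scalerN sq1.2 ?oppr_ge0 ?ltW //.
  by rewrite odd1 ?mulrNN ?mulNr ?mulrN ?opprK // map_f ?mem_enum.
(* Subadditivity gives one inequality; the other comes from adding a term and subtracting it again,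
   since [q1] is odd on multiples of the unit vectors. *)
have lin (t u : 'rV[R]_m) (s : seq 'I_m) :
    q1 (u + \sum_(i <- s) t ord0 i *: delta_mx ord0 i) =
    q1 u + \sum_(i <- s) q1 (delta_mx ord0 i) * t ord0 i.
  elim: s u => [|i s IH] u; first by rewrite !big_nil !addr0.
  rewrite !big_cons !addrA IH; congr (_ + _).
  apply/eqP; rewrite eq_le; apply/andP; split.
    by apply: le_trans (sq1.1 _ _) _; rewrite q1d mulrC.
  rewrite -lerBrDr; apply: le_trans (_ : _ <= q1 (u + t 0 i *: delta_mx 0 i) +
    q1 (- t 0 i *: delta_mx 0 i)) _.
    by apply: le_trans (sq1.1 _ _); rewrite scaleNr addrK.
  by rewrite q1d mulNr [_ * t _ _]mulrC.
have q1E t : q1 t = \sum_(i < m) q1 (delta_mx ord0 i) * t ord0 i.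
  rewrite {1}(row_sum_delta t) -[X in q1 X]add0r lin sublinear0 ?add0r //.
exists (fun i => q1 (delta_mx ord0 i)); split=> [t|].
  by rewrite -q1E; apply: le_trans (le0 _).
by rewrite -q1E q1a q0a.1.
Qed.

(** * Coordinate functionals: linearity, order, norm estimates, continuity *)

Definition psum (R : realType) (E : lmodType R) (e : nat -> E) (a : nat -> R)
  (m : nat) : E := \sum_(i < m) a i *: e i.

(* [I] is the index set of the basis; [e] is normalised to vanish outside of it. *)
Record coordinate_system (R : realType) (E : banachLatticeType R) (I : pred nat)
    (e : nat -> E) (c : nat -> E -> R) : Prop := CoordinateSystem {
  basis_out : forall i, ~~ I i -> e i = 0 ;
  coord_out : forall i x, ~~ I i -> c i x = 0 ;
  coord_cvg : forall x, psum e (c ^~ x) @ \oo --> x ;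
  coord_unique : forall (a : nat -> R) x, (forall i, ~~ I i -> a i = 0) ->
    psum e a @ \oo --> x -> forall i, c i x = a i ;
  coord_order : forall x, lle 0 x <-> forall i, 0 <= c i x }.

Section Coordinates.
Context (R : realType) (E : banachLatticeType R) (I : pred nat).
Context (e : nat -> E) (c : nat -> E -> R).
Hypothesis cs : coordinate_system I e c.

Lemma coord_linear i (k : R) x y : c i (k *: x + y) = k * c i x + c i y.
Proof.
apply: (coord_unique cs (a := fun i => k * c i x + c i y)) => [j Ij|].
  by rewrite !(coord_out cs) // mulr0 addr0.
have -> : psum e (fun i => k * c i x + c i y) =
    (fun m => k *: psum e (c ^~ x) m + psum e (c ^~ y) m).
  apply/funext => m; rewrite /psum scaler_sumr -big_split /=.
  by apply: eq_bigr => j _; rewrite scalerDl scalerA.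
apply: cvgD; last exact: (coord_cvg cs).
by apply: cvgZr; exact: (coord_cvg cs).
Qed.

Lemma coord_null i : c i 0 = 0.
Proof.
have := coord_linear i 1 0 0; rewrite scale1r addr0 mul1r => h.
by apply: (addrI (c i 0)); rewrite -h addr0.
Qed.

Lemma coordZ i (k : R) x : c i (k *: x) = k * c i x.
Proof. by rewrite -[k *: x]addr0 coord_linear coord_null addr0. Qed.

Lemma coordD i x y : c i (x + y) = c i x + c i y.
Proof. by rewrite -[x]scale1r coord_linear mul1r scale1r. Qed.

Lemma coordN i x : c i (- x) = - c i x.
Proof. by rewrite -scaleN1r coordZ mulN1r. Qed.

Lemma coordB i x y : c i (x - y) = c i x - c i y.
Proof. by rewrite coordD coordN. Qed.

Lemma coord_psum i (a : nat -> R) m :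
  c i (psum e a m) = if (i < m)%N && I i then a i else 0.
Proof.
apply: (coord_unique cs (a := fun i => if (i < m)%N && I i then a i else 0)).
  by move=> j /negbTE ->; rewrite andbF.
(* The partial sums of the truncated sequence are constant from [m] on, so uniqueness of the
   expansion identifies the coordinates. *)
apply: cvg_near_cst; exists m => // n /= mn.
rewrite /psum (big_ord_widen_cond n xpredT (fun i => a i *: e i) mn) [RHS]big_mkcond /=.
apply: eq_bigr => j _; have [_|/(basis_out cs) ->] := boolP (I j).
  by rewrite andbT; case: ifP => // _; rewrite scale0r.
by rewrite !scaler0 if_same.
Qed.

Lemma coord_unit i j : c i (e j) = ((i == j) && I i)%:R.
Proof.
have -> : e j = psum e (fun k => (k == j)%:R) j.+1.
  rewrite /psum big_ord_recr /= eqxx scale1r big1 ?add0r // => k _.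
  by rewrite ltn_eqF // scale0r.
rewrite coord_psum ltnS; case: eqVneq => [->|]; last by case: ifP.
by rewrite leqnn /=; case: (I j).
Qed.

Lemma coord_lle x y : lle x y <-> forall i, c i x <= c i y.
Proof.
split=> [xy i|h].
  have /(coord_order cs)/(_ i) : lle 0 (- x + y).
    by have := lle_add2l (- x) x y xy; rewrite addNr.
  by rewrite coordD coordN addrC subr_ge0.
have /(lle_add2l x _ _) : lle 0 (- x + y).
  by apply/(coord_order cs) => i; rewrite coordD coordN addrC subr_ge0.
by rewrite addr0 addNKr.
Qed.

Lemma coord_inj x y : (forall i, c i x = c i y) -> x = y.
Proof. by move=> h; apply: lle_anti; apply/coord_lle => i; rewrite h. Qed.

Lemma coord_ljoin i x y : c i (ljoin x y) = Num.max (c i x) (c i y).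
Proof.
have [hx hy] := (ljoinP x y (ljoin x y)).1 (lle_refl _).
move/coord_lle : (hx) => hx'; move/coord_lle : (hy) => hy'.
apply/eqP; rewrite eq_le ge_max hx' hy' /= andbT.
have [Ii|Ii] := boolP (I i); last by rewrite !(coord_out cs) // maxxx.
(* Lowering the i-th coordinate of an upper bound down to the maximum yields a
   smaller upper bound. *)
pose d := c i (ljoin x y) - Num.max (c i x) (c i y).
have cz j : c j (ljoin x y - d *: e i) =
    if j == i then Num.max (c i x) (c i y) else c j (ljoin x y).
  rewrite coordB coordZ coord_unit; case: eqVneq => [->|] /=; last first.
    by rewrite mulr0 subr0.
  by rewrite Ii mulr1 /d subKr.
have /coord_lle/(_ i) : lle (ljoin x y) (ljoin x y - d *: e i).
  apply/ljoinP; split; apply/coord_lle => j; rewrite cz; case: eqVneq => [->|_] //.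
    by rewrite le_max lexx.
  by rewrite le_max lexx orbT.
by rewrite cz eqxx.
Qed.

Lemma coord_lmeet i x y : c i (lmeet x y) = Num.min (c i x) (c i y).
Proof.
have [hx hy] := (lmeetP x y (lmeet x y)).1 (lle_refl _).
move/coord_lle : (hx) => hx'; move/coord_lle : (hy) => hy'.
apply/eqP; rewrite eq_le le_min hx' hy' /=.
have [Ii|Ii] := boolP (I i); last by rewrite !(coord_out cs) // minxx.
(* Dually to the join, [d <= 0], and subtracting [d *: e i] raises the [i]-th coordinate of the
   lower bound up to the minimum. *)
pose d := c i (lmeet x y) - Num.min (c i x) (c i y).
have cz j : c j (lmeet x y - d *: e i) =
    if j == i then Num.min (c i x) (c i y) else c j (lmeet x y).
  rewrite coordB coordZ coord_unit; case: eqVneq => [->|] /=; last first.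
    by rewrite mulr0 subr0.
  by rewrite Ii mulr1 /d subKr.
have /coord_lle/(_ i) : lle (lmeet x y - d *: e i) (lmeet x y).
  apply/lmeetP; split; apply/coord_lle => j; rewrite cz; case: eqVneq => [->|_] //.
    by rewrite ge_min lexx.
  by rewrite ge_min lexx orbT.
by rewrite cz eqxx.
Qed.

Lemma coord_modulus i x : c i (modulus x) = `|c i x|.
Proof. by rewrite coord_ljoin coordN maxrN. Qed.

(** The modulus is computed coordinatewise, so this is monotonicity of the lattice norm. In
    particular, truncation does not increase the norm and changes of signs preserve it. *)
Lemma coord_norm_mono x y : (forall i, `|c i x| <= `|c i y|) -> `|x| <= `|y|.
Proof.
by move=> h; apply: lle_norm; apply/coord_lle => i; rewrite !coord_modulus.
Qed.

Lemma psum_norm_mono (a b : nat -> R) m :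
  (forall i, (i < m)%N -> `|a i| <= `|b i|) -> `|psum e a m| <= `|psum e b m|.
Proof.
move=> h; apply: coord_norm_mono => i; rewrite !coord_psum.
by case: ifP => // /andP[/h].
Qed.

Lemma psum_coord_le x m : `|psum e (c ^~ x) m| <= `|x|.
Proof.
apply: coord_norm_mono => i; rewrite coord_psum.
by case: ifP; rewrite ?normr0.
Qed.

Lemma coord_norm_le i x : `|c i x| * `|e i| <= `|x|.
Proof.
rewrite -normrZ; apply: coord_norm_mono => j; rewrite coordZ coord_unit.
by case: eqVneq => [->|_] /=; case: (I i); rewrite ?mulr1 ?mulr0 ?normr0.
Qed.

Lemma basis_neq0 i : I i -> 0 < `|e i|.
Proof.
move=> Ii; rewrite normr_gt0; apply/eqP => ei0.
have := coord_unit i i; rewrite eqxx Ii ei0 coord_null => /eqP.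
by rewrite eq_sym oner_eq0.
Qed.

Lemma coord_continuous i : continuous (c i).
Proof.
have [Ii|Ii] := boolP (I i); last first.
  rewrite (_ : c i = fun=> 0); first by move=> x; exact: cvg_cst.
  by apply/funext => x; exact: (coord_out cs).
move=> x; apply/cvgrPdist_le => d d0.
have de0 : 0 < d * `|e i| by rewrite mulr_gt0 // basis_neq0.
have /cvgrPdist_le/(_ _ de0) : (y @[y --> x]) --> x by exact: cvg_id.
apply: filterS => y /= xy; rewrite -coordB.
rewrite -(ler_pM2r (basis_neq0 Ii)).
exact: le_trans (coord_norm_le _ _) xy.
Qed.

(** The default [0] of [insubd] is never a substitute: [coord_dualE] checks that [c i] is linear and
    continuous. *)
Definition coord_dual i : dual E :=
  insubd (0 : dual E) (c i : E -> R).

Lemma coord_dualE i x : coord_dual i x = c i x.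
Proof.
rewrite /coord_dual -[dual_fun _]/(val _) val_insubd.
rewrite ifT //; apply/asboolP; split; last exact: coord_continuous.
by move=> k y z; rewrite coord_linear.
Qed.

Lemma coord_dual_out i : ~~ I i -> coord_dual i = 0.
Proof.
move=> Ii; apply/val_inj/funext => x.
by rewrite [LHS]coord_dualE (coord_out cs).
Qed.

End Coordinates.

Lemma exponent_cases (R : realType) (p : \bar R) : (1 <= p)%E ->
  (exists2 r : R, p = r%:E & 1 <= r) \/ p = +oo%E.
Proof.
case: p => [r| |]; rewrite ?lee_fin.
- by move=> r1; left; exists r.
- by right.
- by rewrite leeNy_eq.
Qed.

(** * The dual space and the norm of the free Banach lattice *)

Section FblNorm.
Context (R : realType) (E : normedModType R).
Implicit Types f g : dual E -> R.

Lemma fbl_norm_finP (r : R) f (C : R) : (fbl_norm r%:E f <= C%:E)%E <->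
  forall n (xs : 'I_n -> dual E), weak_lp_ball r xs ->
    lp_norm r (fun k => f (xs k)) <= C.
Proof.
split=> [h n xs xsB|h].
  rewrite -lee_fin; apply: le_trans h; apply: ereal_sup_ubound.
  by exists n, xs.
by apply: ge_ereal_sup => _ [n [xs [xsB ->]]]; rewrite lee_fin; exact: h.
Qed.

Lemma fbl_norm_inftyP f (C : R) : (fbl_norm +oo f <= C%:E)%E <->
  forall xs, @dual_ball R E xs -> `|f xs| <= C.
Proof.
split=> [h xs xsB|h].
  by rewrite -lee_fin; apply: le_trans h; apply: ereal_sup_ubound; exists xs.
by apply: ge_ereal_sup => _ [xs xsB <-]; rewrite lee_fin; exact: h.
Qed.

Lemma dualZE (xs : dual E) (a : R) x : (a *: xs) x = a * xs x.
Proof. by []. Qed.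

Lemma dual_linear (xs : dual E) (a : R) x y : xs (a *: x + y) = a * xs x + xs y.
Proof. by have /asboolP[+ _] := dual_funP xs; exact. Qed.

Lemma dual0 (xs : dual E) : xs 0 = 0.
Proof. by have := dual_linear xs (-1) 0 0; rewrite scaler0 addr0 mulN1r addNr. Qed.

Lemma dual_scale (xs : dual E) (a : R) x : xs (a *: x) = a * xs x.
Proof. by rewrite -[a *: x]addr0 dual_linear dual0 addr0. Qed.

Lemma dual_sum (xs : dual E) m (F : 'I_m -> E) :
  xs (\sum_(i < m) F i) = \sum_(i < m) xs (F i).
Proof.
elim/big_rec2: _ => [|i y x _ <-]; first exact: dual0.
by rewrite -[F i]scale1r dual_linear mul1r scale1r.
Qed.

Lemma dual_bounded (xs : dual E) : exists K : R, forall x, `|xs x| <= K * `|x|.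
Proof.
have /asboolP[xs_lin xs_cont] := dual_funP xs.
pose xl : {linear E -> R} := HB.pack (dual_fun xs)
  (GRing.isLinear.Build R E R *%R (dual_fun xs) xs_lin).
have /linear_boundedP[K [_ hK]] : bounded_near xl (nbhs 0).
  exact/linear_bounded_continuous.
by exists (K + 1) => x; apply: hK; rewrite ltrDl.
Qed.

Lemma weak_lp_ball_le (r : R) n (xs : 'I_n -> dual E) x : 1 <= r ->
  weak_lp_ball r xs -> \sum_(k < n) `|xs k x| `^ r <= `|x| `^ r.
Proof.
move=> r1 xsB; have rn0 : r != 0 by rewrite gt_eqF // (lt_le_trans _ r1).
have [->|x0] := eqVneq x 0.
  rewrite normr0 powR0 // big1 // => k _; by rewrite dual0 normr0 powR0.
have nx0 : 0 < `|x| by rewrite normr_gt0.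
have := xsB (`|x|^-1 *: x); rewrite normrZ normfV normr_id mulVf ?lt0r_neq0 //.
move=> /(_ (lexx _)) h.
rewrite -[leRHS]mulr1; apply: le_trans (ler_wpM2l (powR_ge0 _ _) h).
rewrite mulr_sumr; apply: ler_sum => k _.
rewrite -powRM // dual_scale normrM normfV normr_id mulrA divff ?mul1r //.
exact: lt0r_neq0.
Qed.

Lemma dual_ball_le (xs : dual E) x : dual_ball xs -> `|xs x| <= `|x|.
Proof.
move=> xsB; have [->|x0] := eqVneq x 0; first by rewrite dual0 !normr0.
have nx0 : 0 < `|x| by rewrite normr_gt0.
have := xsB (`|x|^-1 *: x); rewrite normrZ normfV normr_id mulVf ?lt0r_neq0 //.
move=> /(_ (lexx _)); rewrite dual_scale normrM normfV normr_id.
by rewrite ler_pdivrMl // mulr1.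
Qed.

Context (p : \bar R).
Hypothesis p1 : (1 <= p)%E.

Lemma fbl_norm_mono f g (C : R) : (forall xs, `|f xs| <= `|g xs|) ->
  (fbl_norm p g <= C%:E)%E -> (fbl_norm p f <= C%:E)%E.
Proof.
move=> fg; case: (exponent_cases p1) => [[r -> r1]|->].
  move=> /fbl_norm_finP gC.
  apply/fbl_norm_finP => n xs xsB; apply: le_trans (gC n xs xsB).
  exact: lp_norm_mono.
move=> /fbl_norm_inftyP gC; apply/fbl_norm_inftyP => xs xsB.
exact: le_trans (fg xs) (gC xs xsB).
Qed.

Lemma fbl_normD f g (A B : R) : 0 < A -> 0 < B ->
  (fbl_norm p f <= A%:E)%E -> (fbl_norm p g <= B%:E)%E ->
  (fbl_norm p (f + g)%R <= (A + B)%R%:E)%E.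
Proof.
move=> A0 B0; case: (exponent_cases p1) => [[r -> r1]|->].
  move=> /fbl_norm_finP fA /fbl_norm_finP gB.
  by apply/fbl_norm_finP => n xs xsB; apply: lp_normD => //; [exact: fA|exact: gB].
move=> /fbl_norm_inftyP fA /fbl_norm_inftyP gB.
apply/fbl_norm_inftyP => xs xsB; apply: le_trans (ler_normD _ _) _.
by apply: lerD; [exact: fA|exact: gB].
Qed.

Lemma fbl_normZ f (k C : R) : 0 <= C -> (fbl_norm p f <= C%:E)%E ->
  (fbl_norm p (k *: f)%R <= (`|k| * C)%R%:E)%E.
Proof.
move=> C0; case: (exponent_cases p1) => [[r -> r1]|->].
  move=> /fbl_norm_finP fC; apply/fbl_norm_finP => n xs xsB.
  apply/(lp_norm_leP r1); first exact: mulr_ge0.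
  move/(lp_norm_leP r1) : (fC n xs xsB) => /(_ C0) h.
  rewrite powRM //; apply: le_trans (ler_wpM2l (powR_ge0 _ _) h).
  rewrite mulr_sumr; apply: ler_sum => i _.
  by rewrite -powRM // -normrM.
move=> /fbl_norm_inftyP fC; apply/fbl_norm_inftyP => xs xsB.
by rewrite [(k *: f) xs]/(k * f xs) normrM; apply: ler_wpM2l => //; exact: fC.
Qed.

Lemma fbl_norm_delta x : (fbl_norm p (delta x : dual E -> R) <= `|x|%:E)%E.
Proof.
case: (exponent_cases p1) => [[r -> r1]|->].
  apply/fbl_norm_finP => n xs xsB.
  by apply/(lp_norm_leP r1) => //; exact: weak_lp_ball_le.
by apply/fbl_norm_inftyP => xs xsB; exact: dual_ball_le.
Qed.

(** A Fatou property: each competitor in the supremum involves finitely many functionals only, so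
    pointwise convergence is uniform on them. *)
Lemma fbl_norm_limit (F : nat -> dual E -> R) f (C : R) : 0 < C ->
  (forall L, (fbl_norm p (F L) <= C%:E)%E) ->
  (forall xs, F L xs @[L --> \oo] --> f xs) -> (fbl_norm p f <= C%:E)%E.
Proof.
move=> C0; case: (exponent_cases p1) => [[r -> r1]|->].
  move=> FC Ff; apply/fbl_norm_finP => n xs xsB.
  apply/ler_addgt0Pr => d d0.
  have r0 : 0 <= r^-1 by rewrite invr_ge0 (le_trans _ r1).
  (* A constant vector [d'] of length [n] then has [r]-norm at most [d]; the summand 1 keeps the
     denominator positive when [n = 0]. *)
  pose d' := d / (n%:R `^ r^-1 + 1).
  have den0 : 0 < n%:R `^ r^-1 + 1 :> R.
    by apply: ltr_wpDl => //; exact: powR_ge0.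
  have d'0 : 0 < d' by rewrite divr_gt0.
  have : \forall L \near \oo, forall k : 'I_n, `|f (xs k) - F L (xs k)| <= d'.
    apply: filter_forall => k.
    by move/cvgrPdist_le : (Ff (xs k)) => /(_ _ d'0).
  move=> [L _ /(_ L (leqnn L)) /= hL].
  rewrite (_ : (fun k => f (xs k)) =
    (fun k => F L (xs k) + (f (xs k) - F L (xs k)))); last first.
    by apply/funext => k; rewrite addrC subrK.
  apply: lp_normD => //; first by move/fbl_norm_finP : (FC L); exact.
  apply: le_trans (_ : _ <= lp_norm r (fun _ : 'I_n => d')) _.
    by apply: lp_norm_mono => // k; rewrite [leRHS]ger0_norm // ltW.
  rewrite lp_norm_cst // ger0_norm ?(ltW d'0) // /d' mulrA ler_pdivrMr //.
  by rewrite mulrDr mulr1 mulrC lerDl ltW.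
move=> FC Ff; apply/fbl_norm_inftyP => xs xsB.
apply: (cvgr_to_le (cvg_norm (Ff xs))).
by near=> L; move/fbl_norm_inftyP : (FC L); exact.
Unshelve. all: by end_near.
Qed.

End FblNorm.

(** * The free vector lattice: closure properties and induction *)

Section FreeVectorLattice.
Context (R : realType) (E : normedModType R).
Notation FVL := (@free_vector_lattice R E).

Lemma FVL_sublattice : linear_sublattice FVL.
Proof.
split.
- by move=> A [[A0 _ _ _] _].
- move=> a f g Ff Fg A AS; case: (AS) => -[_ AL _ _] _.
  by apply: AL; [exact: Ff|exact: Fg].
- move=> f g Ff Fg A AS; case: (AS) => -[_ _ AJ _] _.
  by apply: AJ; [exact: Ff|exact: Fg].
- move=> f g Ff Fg A AS; case: (AS) => -[_ _ _ AM] _.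
  by apply: AM; [exact: Ff|exact: Fg].
Qed.

Lemma FVL_delta x : FVL (delta x).
Proof. by move=> A [_]; apply; exists x. Qed.

Lemma FVL_min (A : set (dual E -> R)) :
  linear_sublattice A -> (forall x, A (delta x)) -> FVL `<=` A.
Proof. by move=> AL AD f; apply; split=> // _ [x _ <-]; exact: AD. Qed.

Lemma FVL0 : FVL (fun=> 0).
Proof. by case: FVL_sublattice. Qed.

Lemma FVL_comb (a : R) f g : FVL f -> FVL g -> FVL (a *: f + g).
Proof. by case: FVL_sublattice => _ + _ _; exact. Qed.

Lemma FVLZ (a : R) f : FVL f -> FVL (a *: f).
Proof. by move=> Ff; have := FVL_comb a Ff FVL0; rewrite addr0. Qed.

Lemma FVL_max f g : FVL f -> FVL g -> FVL (fun xs => Num.max (f xs) (g xs)).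
Proof. by case: FVL_sublattice => _ _ + _; exact. Qed.

Lemma FVL_abs f : FVL f -> FVL (fun xs => `|f xs|).
Proof.
move=> Ff; rewrite (_ : (fun=> _) = (fun xs => Num.max (f xs) ((-1 *: f) xs))).
  by apply: FVL_max => //; exact: FVLZ.
by apply/funext => xs; rewrite scaleN1r -maxrN.
Qed.

Lemma FVL_sum m (F : nat -> dual E -> R) : (forall i, FVL (F i)) ->
  FVL (fun xs => \sum_(i < m) F i xs).
Proof.
move=> FF; elim: m => [|m IH].
  rewrite (_ : (fun=> _) = fun=> 0); first exact: FVL0.
  by apply/funext => xs; rewrite big_ord0.
rewrite (_ : (fun=> _) = 1 *: F m + (fun xs => \sum_(i < m) F i xs)).
  exact: FVL_comb.
by apply/funext => xs; rewrite scale1r big_ord_recr /= addrC.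
Qed.

Lemma FVL_homogeneous : FVL `<=` @positively_homogeneous R E.
Proof.
apply: FVL_min => [|x a xs _]; last exact: dualZE.
split.
- by move=> a xs _; rewrite mulr0.
- move=> k f g hf hg a xs a0.
  rewrite [LHS]/(k * f (a *: xs) + g (a *: xs)) hf // hg //.
  by rewrite [(k *: f + g) xs]/(k * f xs + g xs) mulrDr mulrCA.
- by move=> f g hf hg a xs a0; rewrite /fjoin /= hf // hg // maxr_pMr.
- by move=> f g hf hg a xs a0; rewrite /fmeet /= hf // hg // minr_pMr.
Qed.

End FreeVectorLattice.

(** * Disjoint spikes and the upper norm estimate *)

Section DisjointCopy.
Context (R : realType) (E : banachLatticeType R) (I : pred nat).
Context (e : nat -> E) (c : nat -> E -> R).
Hypothesis cs : coordinate_system I e c.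
Implicit Types xs : dual E.

(** Chosen so that [weight i * |xs (e i)|] is dominated by a geometric series for every functional
    [xs]; the summand 1 covers indices with [e i = 0]. *)
Definition weight i : R := 2^-1 ^+ i.+1 / (1 + `|e i|).

Lemma half_pow_gt0 i : 0 < 2^-1 ^+ i :> R.
Proof. by rewrite exprn_gt0 // invr_gt0. Qed.

Lemma weight_gt0 i : 0 < weight i.
Proof. by rewrite divr_gt0 ?half_pow_gt0 // ltr_pwDl. Qed.

Lemma weight_norm_le i : weight i * `|e i| <= 2^-1 ^+ i.+1.
Proof.
have h : 0 < 1 + `|e i| by rewrite ltr_pwDl.
rewrite /weight mulrAC ler_pdivrMr // ler_pM2l ?half_pow_gt0 //.
by rewrite lerDr.
Qed.

Definition weighted_sum xs m : R := \sum_(i < m) weight i * `|xs (e i)|.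

Lemma weighted_sum_nondecreasing xs :
  {homo weighted_sum xs : m n / (m <= n)%N >-> m <= n}.
Proof.
move=> m n mn; rewrite /weighted_sum.
rewrite (big_ord_widen_cond n xpredT (fun i => weight i * `|xs (e i)|) mn).
rewrite big_mkcond /=; apply: ler_sum => i _; case: ifP => // _.
by rewrite mulr_ge0 // ltW // weight_gt0.
Qed.

Lemma weighted_sum_cvg xs : cvgn (weighted_sum xs).
Proof.
apply: nondecreasing_is_cvgn; first exact: weighted_sum_nondecreasing.
have [K hK] := dual_bounded xs.
(* The exact partial sum of the geometric series makes the induction close. *)
have hm m : weighted_sum xs m <= `|K| * (1 - 2^-1 ^+ m).
  elim: m => [|m IH]; first by rewrite /weighted_sum big_ord0 expr0 subrr mulr0.
  rewrite /weighted_sum big_ord_recr /=.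
  have hw : weight m * `|xs (e m)| <= `|K| * 2^-1 ^+ m.+1.
    have := ler_wpM2l (normr_ge0 K) (weight_norm_le m).
    apply: le_trans; rewrite mulrCA; apply: ler_wpM2l; first exact/ltW/weight_gt0.
    by apply: le_trans (hK _) _; apply: ler_wpM2r => //; exact: ler_norm.
  have -> : 2^-1 ^+ m.+1 = 2^-1 ^+ m - 2^-1 ^+ m.+1 :> R.
    by rewrite exprS; lra.
  by move: IH hw; rewrite /weighted_sum exprS; lra.
exists `|K| => _ [m _ <-]; apply: le_trans (hm m) _.
by rewrite ler_piMr // lerBlDr lerDl ltW // half_pow_gt0.
Qed.

Definition weighted_lim xs : R := limn (weighted_sum xs).

Lemma weighted_sum_le xs m : weighted_sum xs m <= weighted_lim xs.
Proof.
apply: nondecreasing_cvgn_le; first exact: weighted_sum_nondecreasing.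
exact: weighted_sum_cvg.
Qed.

Lemma weighted_lim_ge1 xs n : weight n * `|xs (e n)| <= weighted_lim xs.
Proof.
apply: le_trans (weighted_sum_le xs n.+1).
rewrite /weighted_sum big_ord_recr /= lerDr; apply: sumr_ge0 => i _.
by rewrite mulr_ge0 // ltW // weight_gt0.
Qed.

Lemma weighted_lim_ge2 xs n m : (n < m)%N ->
  weight n * `|xs (e n)| + weight m * `|xs (e m)| <= weighted_lim xs.
Proof.
move=> nm; apply: le_trans (weighted_sum_le xs m.+1).
rewrite /weighted_sum big_ord_recr /= lerD2r.
rewrite (bigD1 (Ordinal nm)) //= lerDl; apply: sumr_ge0 => i _.
by rewrite mulr_ge0 // ltW // weight_gt0.
Qed.

Lemma weighted_limZ (k : R) xs : 0 <= k ->
  weighted_lim (k *: xs) = k * weighted_lim xs.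
Proof.
move=> k0; rewrite /weighted_lim.
have -> : weighted_sum (k *: xs) = (fun m => k * weighted_sum xs m).
  apply/funext => m; rewrite /weighted_sum mulr_sumr; apply: eq_bigr => i _.
  by rewrite dualZE normrM ger0_norm // mulrCA.
apply/cvg_lim => //; apply: cvgM; first exact: cvg_cst.
exact: weighted_sum_cvg.
Qed.

Lemma weighted_lim_coord i : I i -> weighted_lim (coord_dual c i) = weight i.
Proof.
move=> Ii; apply/cvg_lim => //; apply: cvg_near_cst.
exists i.+1 => // m /= im; rewrite /weighted_sum (bigD1 (Ordinal im)) //=.
rewrite big1 => [|j ji]; rewrite (coord_dualE cs) (coord_unit cs).
  by rewrite eqxx Ii normr1 mulr1 addr0.
case: eqVneq => [ij|_]; last by rewrite normr0 mulr0.
by case/negP: ji; apply/eqP/val_inj.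
Qed.

(* At most one spike is positive at any given functional: adding up
   [2 w_n x*(e_n) > S] and [2 w_m x*(e_m) > S], where
   [S = sum_i w_i |x*(e_i)|], would give [2 S > 2 S]. *)
Definition spike n xs : R := Num.max 0 (2 * xs (e n) - weighted_lim xs / weight n).

Lemma spike_ge0 n xs : 0 <= spike n xs.
Proof. by rewrite /spike le_max lexx. Qed.

Lemma spike_le n xs : spike n xs <= `|xs (e n)|.
Proof.
rewrite /spike ge_max normr_ge0 /= lerBlDr.
have : `|xs (e n)| <= weighted_lim xs / weight n.
  by rewrite ler_pdivlMr ?weight_gt0 // mulrC weighted_lim_ge1.
by have := ler_norm (xs (e n)); lra.
Qed.

Lemma spike_gt0 n xs : 0 < spike n xs ->
  weighted_lim xs < 2 * (weight n * `|xs (e n)|).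
Proof.
rewrite /spike lt_max ltxx /= subr_gt0 ltr_pdivrMr ?weight_gt0 // => h.
apply: lt_le_trans h _; rewrite -mulrA ler_pM2l // mulrC.
by apply: ler_wpM2l (ler_norm _); exact/ltW/weight_gt0.
Qed.

Lemma spike_disjoint n m xs : 0 < spike n xs -> 0 < spike m xs -> n = m.
Proof.
wlog nm : n m / (n <= m)%N => [h hn hm|].
  have [nm|/ltnW nm] := leqP n m; first exact: h.
  by apply/esym; exact: h.
move=> /spike_gt0 hn /spike_gt0 hm; move: nm; rewrite leq_eqVlt.
by move=> /predU1P[//|/(weighted_lim_ge2 xs) h]; exfalso; lra.
Qed.

Lemma spikeZ n (k : R) xs : 0 <= k -> spike n (k *: xs) = k * spike n xs.
Proof.
move=> k0; rewrite /spike weighted_limZ // dualZE maxr_pMr // mulr0 mulrBr.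
by rewrite [k * (2 * _)]mulrCA -mulrA.
Qed.

Lemma spike_coord i : I i -> spike i (coord_dual c i) = 1.
Proof.
move=> Ii; rewrite /spike weighted_lim_coord // divff ?lt0r_neq0 ?weight_gt0 //.
rewrite (coord_dualE cs) (coord_unit cs) eqxx Ii /= mulr1.
by rewrite max_r //; lra.
Qed.

(** The default index 0 is harmless: it is returned when no spike is positive at [xs], and then
    [spike 0 xs] vanishes as well. *)
Definition active xs : nat := xget 0 [set n | 0 < spike n xs].

Lemma spike_inactive n xs : n != active xs -> spike n xs = 0.
Proof.
move=> na; apply/eqP; rewrite eq_le spike_ge0 andbT leNgt; apply/negP => hn.
have := @xgetPex _ 0 [set n | 0 < spike n xs] (ex_intro _ n hn).
rewrite -/(active xs) /= => /(spike_disjoint hn) na'.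
by rewrite na' eqxx in na.
Qed.

(* The pointwise sum of a_n (spike n), with at most one nonzero term. *)
Definition disjoint_sum (a : nat -> R) : dual E -> R :=
  fun xs => a (active xs) * spike (active xs) xs.

Lemma disjoint_sum_finite (a : nat -> R) J xs :
  (forall n, (J <= n)%N -> a n = 0) ->
  disjoint_sum a xs = \sum_(n < J) a n * spike n xs.
Proof.
move=> aJ; rewrite /disjoint_sum; have [lt|le] := ltnP (active xs) J.
  rewrite (bigD1 (Ordinal lt)) //= big1 ?addr0 // => i ia.
  by rewrite spike_inactive ?mulr0.
rewrite aJ // mul0r big1 // => i _.
by rewrite spike_inactive ?mulr0 // ltn_eqF // (leq_trans (ltn_ord i)).
Qed.

Lemma disjoint_sum_linear (k : R) (a b : nat -> R) :
  disjoint_sum (fun i => k * a i + b i) = k *: disjoint_sum a + disjoint_sum b.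
Proof. by apply/funext => xs; rewrite /disjoint_sum mulrDl -mulrA. Qed.

Lemma disjoint_sum_max (a b : nat -> R) :
  disjoint_sum (fun i => Num.max (a i) (b i)) =
  fjoin (disjoint_sum a) (disjoint_sum b).
Proof.
by apply/funext => xs; rewrite /disjoint_sum maxr_pMl // spike_ge0.
Qed.

Lemma disjoint_sum_min (a b : nat -> R) :
  disjoint_sum (fun i => Num.min (a i) (b i)) =
  fmeet (disjoint_sum a) (disjoint_sum b).
Proof.
by apply/funext => xs; rewrite /disjoint_sum minr_pMl // spike_ge0.
Qed.

Lemma disjoint_sum_coord (a : nat -> R) i : (~~ I i -> a i = 0) ->
  disjoint_sum a (coord_dual c i) = a i.
Proof.
move=> aI; have [Ii|Ii] := boolP (I i); last first.
  rewrite aI // (coord_dual_out cs Ii) /disjoint_sum.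
  by rewrite -(scale0r 0) spikeZ // mul0r mulr0.
have -> : disjoint_sum a (coord_dual c i) = a i * spike i (coord_dual c i).
  rewrite /disjoint_sum; have [<- //|] := eqVneq i (active (coord_dual c i)).
  by move=> /spike_inactive; rewrite spike_coord // => /eqP; rewrite oner_eq0.
by rewrite spike_coord // mulr1.
Qed.

Lemma disjoint_sum_homogeneous (a : nat -> R) :
  positively_homogeneous (disjoint_sum a).
Proof.
(* The case [k = 0] is separate because only strictly positive scaling preserves [active]. *)
move=> k xs; rewrite le_eqVlt => /predU1P[<-|k0].
  rewrite mul0r /disjoint_sum; set n := active _.
  by rewrite spikeZ // mul0r mulr0.
have act : active (k *: xs) = active xs.
  rewrite /active; congr xget; apply/funext => n; apply/propext => /=.
  by rewrite spikeZ ?ltW // pmulr_rgt0.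
by rewrite /disjoint_sum act spikeZ ?ltW // mulrCA.
Qed.

Context (p : \bar R).
Hypothesis p1 : (1 <= p)%E.

Lemma disjoint_sum_norm_le x : (fbl_norm p (disjoint_sum (c ^~ x)) <= `|x|%:E)%E.
Proof.
case: (exponent_cases p1) => [[r -> r1]|->]; last first.
  apply/fbl_norm_inftyP => xs xsB; rewrite /disjoint_sum normrM.
  apply: le_trans (coord_norm_le cs (active xs) x).
  apply: ler_wpM2l => //; rewrite ger0_norm ?spike_ge0 //.
  exact: le_trans (spike_le _ _) (dual_ball_le _ xsB).
apply/fbl_norm_finP => n xs xsB.
apply/(lp_norm_leP r1) => //.
apply: le_trans (_ : _ <= \sum_(k < n)
    `|c (active (xs k)) x * xs k (e (active (xs k)))| `^ r) _.
  apply: ler_sum => k _; apply: powR_le => //.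
  rewrite /disjoint_sum !normrM; apply: ler_wpM2l => //.
  by rewrite ger0_norm ?spike_ge0 // spike_le.
(* [J] exceeds every active index, so the selected entries lie in the first [J] columns of the
   matrix [c j x * xs k (e j)]. *)
pose J := (\max_(k < n) active (xs k)).+1.
apply: (@diagonal_le _ r r1 n xpredT J (fun k j => c j x * xs k (e j))
  (fun k => active (xs k))) => [k _|s].
  by rewrite ltnS (leq_bigmax_cond (F := fun k => active (xs k))).
(* A signed row sum is the value of [xs k] at a truncation of [x] with changed signs, whose norm is
   at most that of [x]. *)
apply: le_trans (_ : _ <= `|psum e (fun j => (-1) ^+ s j * c j x) J| `^ r) _.
  apply: le_trans (weak_lp_ball_le _ r1 xsB); apply: ler_sum => k _.
  rewrite /psum dual_sum le_eqVlt; apply/orP; left; apply/eqP; congr (`|_| `^ _).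
  by apply: eq_bigr => j _; rewrite dual_scale mulrA.
apply: powR_le => //; apply: le_trans (psum_coord_le cs x J).
by apply: (psum_norm_mono cs) => i _; rewrite normrMsign.
Qed.

(** The full weighted series is thus a norm limit of its partial sums, which belong to the free
    vector lattice; this is what puts the spikes into its closure. *)
Lemma weighted_tail_norm M :
  (fbl_norm p (fun xs => (weighted_lim xs - weighted_sum xs M)%R) <=
   (2 * 2^-1 ^+ M)%R%:E)%E.
Proof.
pose F L xs := weighted_sum xs (L + M) - weighted_sum xs M.
have h0 := half_pow_gt0.
apply: (@fbl_norm_limit _ _ p p1 F); first by rewrite mulr_gt0.
  move=> L.
  (* The subtracted term leaves room for the induction on [L]: the next summand costs
     [2^-1 ^+ (L + M).+1], exactly the growth of this bound. *)
  suff : (fbl_norm p (F L) <= (2 * 2^-1 ^+ M - 2^-1 ^+ (L + M)%N)%R%:E)%E.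
    move=> /le_trans; apply; rewrite lee_fin.
    by have := h0 (L + M)%N; lra.
  elim: L => [|L IH].
    have F0 xs : `|F 0%N xs| <= `|delta 0 xs|.
      by rewrite /F add0n subrr normr0.
    apply: (fbl_norm_mono p1 F0); apply: le_trans (fbl_norm_delta p1 0) _.
    by rewrite normr0 lee_fin add0n; have := h0 M; lra.
  pose g : dual E -> R := fun xs => weight (L + M) * `|xs (e (L + M)%N)|.
  have gB : (fbl_norm p g <= (2^-1 ^+ (L + M).+1)%R%:E)%E.
    have gle xs : `|g xs| <= `|(weight (L + M) *: delta (e (L + M)%N)) xs|.
      by rewrite /g [leRHS]normrM normrM normr_id.
    apply: (fbl_norm_mono p1 gle).
    apply: le_trans (fbl_normZ p1 _ (normr_ge0 _) (fbl_norm_delta p1 _)) _.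
    by rewrite lee_fin gtr0_norm ?weight_gt0 // weight_norm_le.
  have FS : F L.+1 = F L + g.
    apply/funext => xs; rewrite [RHS]/(F L xs + g xs) /F /g addSn.
    by rewrite {1}/weighted_sum big_ord_recr /= -/(weighted_sum _ _) addrAC.
  have hA : 0 < 2 * 2^-1 ^+ M - 2^-1 ^+ (L + M) :> R.
    have : 2^-1 ^+ (L + M) <= 2^-1 ^+ M :> R.
      rewrite exprD ler_piMl ?(ltW (h0 M)) // exprn_ile1 // ?invr_ge0 //.
      by rewrite invf_le1 // ler1n.
    by have := h0 M; lra.
  rewrite FS; apply: le_trans (fbl_normD p1 hA (h0 _) IH gB) _.
  by rewrite lee_fin addSn [in leLHS]exprS exprS; lra.
move=> xs; apply: cvgB; last exact: cvg_cst.
by rewrite (cvg_shiftn M (weighted_sum xs)); exact: weighted_sum_cvg.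
Qed.

End DisjointCopy.

(** * The lower norm estimate from [p]-convexity *)

Section LowerBound.
Context (R : realType) (E : banachLatticeType R) (I : pred nat).
Context (e : nat -> E) (c : nat -> E -> R).
Hypothesis cs : coordinate_system I e c.

Lemma psumZ (k : R) (a : nat -> R) m :
  psum e (fun i => k * a i) m = k *: psum e a m.
Proof. by rewrite /psum scaler_sumr; apply: eq_bigr => i _; rewrite scalerA. Qed.

Lemma psum_ext (a b : nat -> R) m : (forall i, (i < m)%N -> a i = b i) ->
  psum e a m = psum e b m.
Proof. by move=> ab; apply: eq_bigr => i _; rewrite ab. Qed.

(* On the span of finitely many basis vectors Krivine's calculus is computed
   coordinatewise. *)
Lemma p_convex_psum (r : R) (a b : nat -> R) m : p_convex E r%:E 1 ->
  `|psum e (fun i => (`|a i| `^ r + `|b i| `^ r) `^ r^-1) m| <=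
  (`|psum e a m| `^ r + `|psum e b m| `^ r) `^ r^-1.
Proof.
move=> pc; pose ab i (k : 'I_2) := if k == ord0 then a i else b i.
pose Phi (h : 'rV[R]_2 -> R) := psum e (fun i => h (\row_k ab i k)) m.
have kr : krivine_calculus (fun k : 'I_2 => psum e (ab ^~ k) m) Phi.
  split=> [|k]; last by apply: psum_ext => i _; rewrite mxE.
  split=> [k f g _ _|f g _ _|f g _ _]; apply: (coord_inj cs) => i.
  - rewrite (coord_linear cs) !(coord_psum cs).
    by case: ifP => // _; rewrite mulr0 addr0.
  - rewrite (coord_ljoin cs) !(coord_psum cs).
    by case: ifP => // _; rewrite maxxx.
  - rewrite (coord_lmeet cs) !(coord_psum cs).
    by case: ifP => // _; rewrite minxx.
have := pc _ _ _ kr; rewrite mul1r /Phi /lp_norm.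
rewrite !big_ord_recl big_ord0 /= !addr0 !normr_id => h.
apply: le_trans h; rewrite le_eqVlt; apply/orP; left; apply/eqP; congr (`|_|).
by apply: psum_ext => i _; rewrite !big_ord_recl big_ord0 !mxE addr0.
Qed.

Section FiniteExponent.
Context (r : R).
Hypotheses (r1 : 1 <= r) (pc : p_convex E r%:E 1).

Let r0 : 0 < r. Proof. exact: lt_le_trans r1. Qed.
Let rn0 : r != 0. Proof. by rewrite gt_eqF. Qed.

Definition extend m (t : 'rV[R]_m) (i : nat) : R :=
  if insub i is Some j then t ord0 j else 0.

Lemma extend_ord m (t : 'rV[R]_m) (j : 'I_m) : extend t j = t ord0 j.
Proof. by rewrite /extend valK. Qed.

(* The norm of the p-concavification of E, composed with the positive part so
   that functionals dominated by it are positive. *)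
Definition concavified_norm m (t : 'rV[R]_m) : R :=
  `|psum e (fun i => Num.max 0 (extend t i) `^ r^-1) m| `^ r.

(** Subadditivity is [p]-convexity for the two vectors whose coordinates are the [r]-th roots of the
    positive parts of [s] and [t], combined with subadditivity of the positive part. *)
Lemma concavified_norm_sublinear m : sublinear (@concavified_norm m).
Proof.
split=> [s t|k t k0].
  pose a i := Num.max 0 (extend s i) `^ r^-1.
  pose b i := Num.max 0 (extend t i) `^ r^-1.
  have := p_convex_psum a b m pc; set z := psum e _ m => h.
  have aR i : `|a i| `^ r = Num.max 0 (extend s i).
    by rewrite ger0_norm ?powR_ge0 // powRVK // le_max lexx.
  have bR i : `|b i| `^ r = Num.max 0 (extend t i).
    by rewrite ger0_norm ?powR_ge0 // powRVK // le_max lexx.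
  apply: le_trans (_ : _ <= `|z| `^ r) _; last first.
    rewrite -[leRHS](powRVK r1) ?addr_ge0 ?powR_ge0 //.
    exact: powR_le.
  apply: powR_le => //; apply: (psum_norm_mono cs) => i im.
  rewrite aR bR !ger0_norm ?powR_ge0 //.
  apply: ge0_ler_powR; rewrite ?nnegrE ?invr_ge0 ?(ltW r0) //.
  - by rewrite le_max lexx.
  - by rewrite addr_ge0 // le_max lexx.
  - rewrite -[i]/(val (Ordinal im)) !extend_ord mxE.
    by rewrite ge_max addr_ge0 ?le_max ?lexx //= lerD // le_max lexx orbT.
rewrite /concavified_norm.
have -> : psum e (fun i => Num.max 0 (extend (k *: t) i) `^ r^-1) m =
    k `^ r^-1 *: psum e (fun i => Num.max 0 (extend t i) `^ r^-1) m.
  rewrite -psumZ; apply: psum_ext => i im.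
  rewrite -powRM ?le_max ?lexx // maxr_pMr // mulr0.
  by rewrite -[i]/(val (Ordinal im)) !extend_ord mxE.
rewrite normrZ powRM // ger0_norm ?powR_ge0 //.
by rewrite powRVK.
Qed.

Lemma concavified_norm_powR m (g : nat -> R) : (forall i, 0 <= g i) ->
  concavified_norm (\row_(i < m) g i `^ r) = `|psum e g m| `^ r.
Proof.
move=> g0; congr (`|_| `^ _); apply: psum_ext => i im.
rewrite -[i]/(val (Ordinal im)) extend_ord mxE max_r ?powR_ge0 //.
by rewrite powRK.
Qed.

Lemma psum_norm_le_fbl_fin (f : dual E -> R) (C : R) m :
  positively_homogeneous f -> (fbl_norm r%:E f <= C%:E)%E ->
  `|psum e (fun i => f (coord_dual c i)) m| <= C.
Proof.
move=> fh /fbl_norm_finP fC.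
pose g i := `|f (coord_dual c i)|.
have g0 i : 0 <= g i by exact: normr_ge0.
have [b [b_le b_eq]] := hahn_banach_rV
  (\row_(i < m) g i `^ r) (concavified_norm_sublinear m).
(* Tested at minus a unit vector, where the positive part makes [concavified_norm] vanish. *)
have b0 i : 0 <= b i.
  have := b_le (- delta_mx ord0 i).
  rewrite (bigD1 i) //= big1 => [|j ji]; rewrite !mxE ?eqxx; last first.
    by rewrite (negbTE ji) oppr0 mulr0.
  suff -> : concavified_norm (- delta_mx ord0 i) = 0 by rewrite mulrN1; lra.
  rewrite /concavified_norm /psum big1 ?normr0 ?powR0 // => j _.
  rewrite extend_ord !mxE max_l; first by rewrite powR0 ?scale0r ?invr_eq0.
  by rewrite oppr_le0 ler0n.
(* The scaling gives [|xs i x| ^ r = b i * |c i x| ^ r], so domination by [concavified_norm] becomes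
   weak summability. *)
pose xs (i : 'I_m) : dual E := b i `^ r^-1 *: coord_dual c i.
have xsB : weak_lp_ball r xs.
  move=> x x1; pose h i := `|c i x|.
  have h0 i : 0 <= h i by exact: normr_ge0.
  apply: le_trans (_ : _ <= concavified_norm (\row_(i < m) h i `^ r)) _.
    apply: le_trans (b_le _); apply: ler_sum => i _.
    rewrite dualZE (coord_dualE cs) normrM powRM // ger0_norm ?powR_ge0 //.
    by rewrite powRVK // mxE.
  rewrite concavified_norm_powR // (_ : 1 = 1 `^ r :> R); last by rewrite powR1.
  apply: powR_le => //.
  apply: le_trans x1; apply: le_trans (psum_coord_le cs x m).
  by apply: (psum_norm_mono cs) => i _; rewrite normr_id.
apply: le_trans (fC _ _ xsB).
apply: le_trans (_ : _ <= `|psum e g m|) _.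
  by apply: (psum_norm_mono cs) => i _; rewrite normr_id.
(* Here the equality in Hahn-Banach enters: by homogeneity of [f], the norm of [psum e g m] is the
   [r]-norm of the values of [f] at the [xs i]. *)
rewrite -[leLHS](powRK r1) // -concavified_norm_powR // -b_eq.
rewrite le_eqVlt; apply/orP; left; apply/eqP; congr (_ `^ _).
apply: eq_bigr => i _; rewrite fh ?powR_ge0 // normrM powRM // mxE.
by rewrite [X in X `^ r * _]ger0_norm ?powR_ge0 // powRVK.
Qed.

End FiniteExponent.

(** The functionals [|e i| *: coord_dual c i] lie in the dual ball, so each term
    [f (coord_dual c i) *: e i] has norm at most [C]. The join of the moduli of these terms
    dominates their sum coordinatewise, and convexity bounds that join. *)
Lemma psum_norm_le_fbl_infty (f : dual E -> R) (C : R) m :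
  p_convex E +oo 1 ->
  positively_homogeneous f -> (fbl_norm +oo f <= C%:E)%E ->
  `|psum e (fun i => f (coord_dual c i)) m| <= C.
Proof.
move=> pc fh /fbl_norm_inftyP fC.
have fi i : `|f (coord_dual c i) *: e i| <= C.
  rewrite normrZ mulrC -[X in X * _]normr_id -normrM -fh //.
  apply: fC => x x1; rewrite dualZE (coord_dualE cs) normrM normr_id mulrC.
  exact: le_trans (coord_norm_le cs i x) x1.
have C0 : 0 <= C by apply: le_trans (fi 0%N).
case: m => [|n]; first by rewrite /psum big_ord0 normr0.
have := pc n (fun k => f (coord_dual c k) *: e k); set z := \big[_/_]_(_ < _) _.
rewrite mul1r => zle; apply: le_trans (_ : _ <= `|z|) _; last first.
  by apply: le_trans zle _; apply: bigmax_le => // i _; rewrite normr_id.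
apply: (coord_norm_mono cs) => i; rewrite (coord_psum cs).
case: ifP => [/andP[im Ii]|_]; last by rewrite normr0.
apply: le_trans (ler_norm _).
rewrite /z (big_morph (c i) (coord_ljoin cs i) (erefl _)).
apply: le_trans (le_bigmax _ _ (Ordinal im)).
by rewrite (coord_modulus cs) (coordZ cs) (coord_unit cs) eqxx Ii mulr1.
Qed.

Lemma psum_norm_le_fbl (p : \bar R) (f : dual E -> R) (C : R) m :
  (1 <= p)%E -> p_convex E p 1 ->
  positively_homogeneous f -> (fbl_norm p f <= C%:E)%E ->
  `|psum e (fun i => f (coord_dual c i)) m| <= C.
Proof.
move=> /exponent_cases[[r -> r1]|->] pc; first exact: psum_norm_le_fbl_fin.
exact: psum_norm_le_fbl_infty.
Qed.

End LowerBound.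

(** * The isometric copy lies in the free Banach lattice; coordinates of its elements *)

Section Isomorphism.
Context (R : realType) (E : banachLatticeType R) (I : pred nat).
Context (e : nat -> E) (c : nat -> E -> R) (p : \bar R).
Hypothesis cs : coordinate_system I e c.
Hypothesis p1 : (1 <= p)%E.
Notation copy x := (disjoint_sum e (fun i => c i x)).

Lemma psumB (a b : nat -> R) m :
  psum e (fun i => a i - b i) m = psum e a m - psum e b m.
Proof. by rewrite /psum -sumrB; apply: eq_bigr => i _; rewrite scalerBl. Qed.

Lemma fbl_norm_eq_norm (f : dual E -> R) x : p_convex E p 1 ->
  positively_homogeneous f -> (forall i, c i x = f (coord_dual c i)) ->
  (`|x|%:E <= fbl_norm p f)%E.
Proof.
move=> pc fh xf.
have le_real (C : R) : (fbl_norm p f <= C%:E)%E -> `|x| <= C.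
  move=> fC; apply: (cvgr_to_le (cvg_norm (@coord_cvg _ _ _ _ _ cs x))).
  apply: nearW => m; rewrite (psum_ext e (b := fun i => f (coord_dual c i))) //.
  exact: (psum_norm_le_fbl cs m p1 pc).
case: (fbl_norm p f) le_real => [C| |] le_real.
- by rewrite lee_fin; exact: le_real.
- exact: leey.
(* The value [-oo] would bound the norm of [x] by -1. *)
- exfalso; have := le_real (-1)%R (leNye _); have := normr_ge0 x; lra.
Qed.

Lemma copy_norm x : p_convex E p 1 -> fbl_norm p (copy x) = `|x|%:E.
Proof.
move=> pc; apply/eqP; rewrite eq_le (disjoint_sum_norm_le cs p1) /=.
apply: fbl_norm_eq_norm pc _ _; first exact: disjoint_sum_homogeneous.
move=> i; rewrite (disjoint_sum_coord cs) //; exact: (coord_out cs).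
Qed.

(** Evaluation at the coordinate functionals respects the lattice operations, as do the coordinates
    in [E]; so the functions with this property form a linear sublattice containing every
    [delta x]. *)
Lemma FVL_coordinates (g : dual E -> R) : free_vector_lattice g ->
  exists x, forall i, c i x = g (coord_dual c i).
Proof.
move: g; apply: (FVL_min (A := [set g | exists x, forall i, c i x = g (coord_dual c i)])).
  split=> [|k f g [x xf] [y yg]|f g [x xf] [y yg]|f g [x xf] [y yg]].
  - by exists 0 => i; rewrite (coord_null cs).
  - by exists (k *: x + y) => i; rewrite (coord_linear cs) xf yg.
  - by exists (ljoin x y) => i; rewrite (coord_ljoin cs) xf yg.
  - by exists (lmeet x y) => i; rewrite (coord_lmeet cs) xf yg.
by move=> x; exists x => i; rewrite /delta (coord_dualE cs).
Qed.

(** For an approximant [g] from the free vector lattice the partial sums converge, and the lower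
    estimate applied to [f - g] keeps those of [f] uniformly close; hence they are Cauchy. *)
Lemma FBL_coordinates (f : dual E -> R) : p_convex E p 1 -> FBL E p f ->
  exists x, forall i, c i x = f (coord_dual c i).
Proof.
move=> pc [fh _ fapprox].
pose a i := f (coord_dual c i).
have cvga : cvgn (psum e a).
  apply/cauchy_cvgP; apply: cauchy_exP => eps eps0.
  (* Two errors of at most [eps / 3] stay strictly below [eps], as the open ball requires. *)
  have eps2 : 0 < eps / 3 by rewrite divr_gt0.
  have [g gF fg] := fapprox _ eps2; have [x xg] := FVL_coordinates gF.
  exists x; have /cvgrPdist_le/(_ _ eps2) := @coord_cvg _ _ _ _ _ cs x.
  apply: filterS => m hm; rewrite -ball_normE /=.
  have -> : x - psum e a m = (x - psum e (c ^~ x) m) -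
      psum e (fun i => (f - g) (coord_dual c i)) m.
    rewrite [X in _ = _ - X](_ : _ = psum e a m - psum e (c ^~ x) m).
      by rewrite opprB addrA subrK.
    by rewrite -psumB; apply: psum_ext => i _; rewrite xg.
  have fgh : positively_homogeneous (f - g).
    move=> k xs k0; rewrite -[LHS]/(f (k *: xs) - g (k *: xs)).
    by rewrite -[(f - g) xs]/(f xs - g xs) fh // (FVL_homogeneous gF) // mulrBr.
  have := psum_norm_le_fbl cs m p1 pc fgh (ltW fg).
  have := ler_normB (x - psum e (c ^~ x) m)
    (psum e (fun i => (f - g) (coord_dual c i)) m).
  by lra.
exists (limn (psum e a)) => i; apply: (@coord_unique _ _ _ _ _ cs a _ _ cvga i) => j Ij.
rewrite /a (coord_dual_out cs Ij).
by have := fh 0 0 (lexx 0); rewrite scale0r mul0r.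
Qed.

Lemma max0_lip (u v : R) : `|Num.max 0 u - Num.max 0 v| <= `|u - v|.
Proof.
rewrite ler_norml; have := ler_norm (u - v); have := ler_norm (v - u).
rewrite distrC; have := normr_ge0 (u - v).
by case: (leP 0 u) => hu; case: (leP 0 v) => hv h1 h2 h3; apply/andP; split; lra.
Qed.

(** The approximation has two stages: [x] is truncated to a finite sum [z], and in the finitely many
    spikes left the weighted series is cut off at [M]. *)
Lemma copy_FBL x : FBL E p (copy x).
Proof.
split; first exact: disjoint_sum_homogeneous.
  exact: le_lt_trans (disjoint_sum_norm_le cs p1 x) (ltry _).
move=> eps eps0; have eps4 : 0 < eps / 4 by rewrite divr_gt0.
have /cvgrPdist_le/(_ _ eps4)[J _ /(_ J (leqnn J))] := @coord_cvg _ _ _ _ _ cs x.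
set z := psum e _ J => /= xz.
(* Cutting the series at [M] changes spike [n] by at most the tail divided by [weight e n], so [K]
   times the tail bounds the total error. *)
pose K := \sum_(n < J) `|c n z| / weight e n.
have K0 : 0 <= K.
  by apply: sumr_ge0 => n _; rewrite divr_ge0 // ltW // weight_gt0.
have [M hM] : exists M, K * (2 * 2^-1 ^+ M) <= eps / 4.
  have h1 : `|2^-1| < 1 :> R.
    by rewrite ger0_norm ?invr_ge0 // invf_lt1 // ltr1n.
  have d0 : 0 < eps / 4 / (2 * (K + 1)).
    by rewrite divr_gt0 // mulr_gt0 // ltr_wpDl.
  have /cvgrPdist_le/(_ _ d0)[M _ /(_ M (leqnn M))] := cvg_expr h1.
  rewrite /= sub0r normrN ger0_norm ?exprn_ge0 ?invr_ge0 //.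
  rewrite ler_pdivlMr ?mulr_gt0 ?ltr_wpDl // => h; exists M.
  by have := @half_pow_gt0 R M; lra.
pose u n (xs : dual E) := Num.max 0 (2 * xs (e n) - weighted_sum e xs M / weight e n).
exists (fun xs => \sum_(n < J) c n z * u n xs).
  apply: (@FVL_sum R E J (fun n xs => c n z * u n xs)) => n.
  have -> : (fun xs => c n z * u n xs) = c n z *: u n by [].
  apply: FVLZ; apply: FVL_max; first exact: FVL0.
  have -> : (fun xs : dual E => 2 * xs (e n) - weighted_sum e xs M / weight e n) =
     2 *: delta (e n) + - (weight e n)^-1 *: (fun xs => weighted_sum e xs M).
    apply/funext => xs; rewrite [RHS]/(2 * xs (e n) +
      - (weight e n)^-1 * weighted_sum e xs M).
    by rewrite mulNr [_^-1 * _]mulrC.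
  apply: FVL_comb; first exact: FVL_delta.
  apply: FVLZ; apply: (@FVL_sum R E M (fun i xs => weight e i * `|xs (e i)|)) => i.
  apply: (@FVLZ _ _ (weight e i) (fun xs => `|delta (e i) xs|)).
  by apply: FVL_abs; exact: FVL_delta.
set g := (fun xs : dual E => \sum_(n < J) _).
have yle : (fbl_norm p (copy (x - z)%R) <= (eps / 4)%R%:E)%E.
  by apply: le_trans (disjoint_sum_norm_le cs p1 _) _; rewrite lee_fin.
have zle : (fbl_norm p (copy z - g)%R <= (eps / 4)%R%:E)%E.
  pose tail xs := weighted_lim e xs - weighted_sum e xs M.
  have le_tail xs : `|(copy z - g) xs| <= `|(K *: tail) xs|.
    rewrite -[(copy z - g) xs]/(copy z xs - g xs).
    rewrite (disjoint_sum_finite e (J := J)); last first.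
      by move=> n Jn; rewrite (coord_psum cs) ltnNge Jn.
    rewrite /g -sumrB; apply: le_trans (ler_norm_sum _ _ _) _.
    rewrite [leRHS]normrM (ger0_norm K0) mulr_suml; apply: ler_sum => n _.
    rewrite -mulrBr normrM -mulrA; apply: ler_wpM2l => //.
    apply: le_trans (max0_lip _ _) _.
    rewrite opprB addrC addrA subrK -mulrBl normrM mulrC.
    rewrite (@ger0_norm _ (_^-1)) ?invr_ge0 ?(ltW (weight_gt0 e n)) //.
    by rewrite distrC.
  apply: (fbl_norm_mono p1 le_tail).
  have t0 : 0 <= 2 * 2^-1 ^+ M :> R by rewrite mulr_ge0 // ltW // half_pow_gt0.
  apply: le_trans (fbl_normZ p1 K t0 (weighted_tail_norm e p1 M)) _.
  by rewrite (ger0_norm K0) lee_fin.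
have -> : copy x - g = copy (x - z) + (copy z - g).
  rewrite addrA; congr (_ - _); rewrite -[copy (x - z)]scale1r.
  rewrite -disjoint_sum_linear; congr disjoint_sum; apply/funext => i.
  by rewrite mul1r -(coordD cs) subrK.
apply: le_lt_trans (fbl_normD p1 eps4 eps4 yle zle) _.
by rewrite lte_fin; lra.
Qed.

End Isomorphism.

(** * Coordinates from a Schauder basis, and the projection *)

Lemma basis_coordinate_system (R : realType) (E : banachLatticeType R)
    (N : option nat) (e : nat -> E) :
  schauder_basis N e -> order_induced_by N e ->
  exists (e' : nat -> E) (c : nat -> E -> R),
    coordinate_system (basis_index N) e' c.
Proof.
move=> sb ord.
(* The values of [e] outside the index set are arbitrary; replacing them by 0 leaves every expansion
   unchanged, since the coefficients vanish there. *)
pose e' i := if basis_index N i then e i else 0.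
have psumE (a : nat -> R) : (forall i, ~~ basis_index N i -> a i = 0) ->
    psum e' a = series (fun i => a i *: e i).
  move=> aN; apply/funext => m; rewrite /psum /series /= big_mkord.
  apply: eq_bigr => i _; rewrite /e'; case: ifP => // /negbT /aN ->.
  by rewrite !scale0r.
have [c hc] : {c : E -> nat -> R | forall x, expansion N e (c x) x}.
  have h x : {a | expansion N e a x}.
    by apply: cid; have [a [ha _]] := sb x; exists a.
  by exists (fun x => projT1 (h x)) => x; exact: projT2 (h x).
exists e', (fun i x => c x i); split.
- by move=> i /negbTE; rewrite /e' => ->.
- by move=> i x; apply: (hc x).1.
- by move=> x; rewrite psumE; [exact: (hc x).2|exact: (hc x).1].
- move=> a x aN ax i; have [b [_ b_unique]] := sb x.
  rewrite -(b_unique (c x)) // -(b_unique a) //; split=> //.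
  by rewrite -psumE.
- by move=> x; exact: ord (hc x).
Qed.

Theorem theorem8p3 (R : realType) (p : \bar R) (E : banachLatticeType R)
    (N : option nat) (e : nat -> E) :
  (1 <= p)%E ->
  p_convex E p 1 ->
  schauder_basis N e ->
  one_unconditional N e ->
  order_induced_by N e ->
  exists T : E -> (dual E -> R),
    [/\ lattice_hom_on [set: E] ljoin lmeet (@fjoin R _) (@fmeet R _) T,
        forall x : E, fbl_norm p (T x) = `|x|%:E,
        range T `<=` FBL E p
      & exists P : (dual E -> R) -> (dual E -> R),
        [/\ lattice_hom_on (FBL E p) (@fjoin R _) (@fmeet R _)
              (@fjoin R _) (@fmeet R _) P,
            P @` FBL E p = range T,
            forall f, FBL E p f -> P (P f) = P f
          & forall f, FBL E p f -> (fbl_norm p (P f) <= fbl_norm p f)%E]].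

Proof.
move=> p1 pc sb _ ord.
have [e' [c cs]] := basis_coordinate_system sb ord.
pose T x := disjoint_sum e' (fun i => c i x).
pose P (f : dual E -> R) := disjoint_sum e' (fun i => f (coord_dual c i)).
(* [FBL_coordinates] supplies such an [x] for every [f] in [FBL E p], so the range, idempotence and
   contractivity of [P] all reduce to properties of [T]. *)
have PT f x : (forall i, c i x = f (coord_dual c i)) -> P f = T x.
  by move=> xf; congr disjoint_sum; apply/funext => i; rewrite xf.
have T_coord x i : T x (coord_dual c i) = c i x.
  by apply: (disjoint_sum_coord cs) => Ii; exact: (coord_out cs).
exists T; split.
- split=> [a x y _ _|x y _ _|x y _ _]; rewrite /T.
  + rewrite -disjoint_sum_linear; congr disjoint_sum; apply/funext => i.
    exact: (coord_linear cs).
  + rewrite -disjoint_sum_max; congr disjoint_sum; apply/funext => i.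
    exact: (coord_ljoin cs).
  + rewrite -disjoint_sum_min; congr disjoint_sum; apply/funext => i.
    exact: (coord_lmeet cs).
- by move=> x; exact: (copy_norm cs p1).
- by move=> _ [x _ <-]; exact: (copy_FBL cs p1).
exists P; split.
- split=> [a f g _ _|f g _ _|f g _ _]; rewrite /P.
  + by rewrite -disjoint_sum_linear.
  + by rewrite -disjoint_sum_max.
  + by rewrite -disjoint_sum_min.
- apply/seteqP; split=> [_ [f /(FBL_coordinates cs p1 pc)[x xf] <-]|_ [x _ <-]].
    by exists x => //; rewrite (PT f x).
  exists (T x); first exact: (copy_FBL cs p1).
  by apply: PT => i; rewrite T_coord.
- move=> f /(FBL_coordinates cs p1 pc)[x xf].
  by rewrite (PT f x) // (PT (T x) x) // => i; rewrite T_coord.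
- move=> f fF; have [x xf] := FBL_coordinates cs p1 pc fF.
  rewrite (PT f x) // (copy_norm cs p1) //.
  by case: fF => fh _ _; exact: (fbl_norm_eq_norm cs p1).
Qed.
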